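(* Let $\phi:\mathcal{H}\rightarrow\mathbb{R}$ be a convex and continuous function and let $\{\lambda_k\}_{k=0}^{\infty}\subset[\varepsilon,1+\rho_{\{U_i\}_{i=1}^m}-\varepsilon]$, where $\varepsilon>0$, be a sequence of positive numbers. Let $x^0\in\mathcal{H}$ and let $\{x^k\}_{k=0}^{\infty}$ be the sequence generated by the basic algorithm (defined in the context) with respect to $\{\lambda_k\}_{k=0}^{\infty}$, and suppose that it converges strongly to a point $x\in C$. Let $y^0=x^0$ and suppose that the sequence $\{y^k\}_{k=0}^{\infty}$, generated by the corresponding superiorized algorithm (defined in the context, with the same operators, the same $\{\lambda_k\}_{k=0}^\infty$ and the function $\phi$), converges strongly to a point $y\in C$. Then exactly one of the following two alternatives holds: (i) $\phi(y)\le\phi(x)$; (ii) $\phi(y)>\phi(x)$ and there exists $k_0\in\mathbb{N}$ such that $\|y^{k+1}-x^{k+1}\|<\|y^k-x^k\|$ for all natural $k\ge k_0$.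
   Context: $\mathbb{N}$ starts from $0$. $\mathcal{H}$ is a real Hilbert space with inner product $\langle\cdot,\cdot\rangle$ and induced norm $\|\cdot\|$; $Id$ is the identity operator; $\mathrm{Fix}\,T:=\{x\in\mathcal{H}\mid T(x)=x\}$. For an operator $T:\mathcal{H}\to\mathcal{H}$ and $\lambda\in[0,2]$, the $\lambda$-relaxation of $T$ is $T_\lambda:=(1-\lambda)Id+\lambda T$. An operator $T$ is firmly nonexpansive if $\langle T(x)-T(y),x-y\rangle\ge\|T(x)-T(y)\|^2$ for all $x,y\in\mathcal{H}$; it is $\lambda$-relaxed firmly nonexpansive if $T=U_\lambda$ for some firmly nonexpansive $U$. For convex $\phi:\mathcal{H}\to\mathbb{R}$, the subdifferential at $x$ is $\partial\phi(x):=\{g\in\mathcal{H}\mid\langle g,y-x\rangle\le\phi(y)-\phi(x)\text{ for all }y\in\mathcal{H}\}$; it is nonempty for every $x$ when $\phi$ is convex and continuous. For a sequence of sets, $\limsup_{k\to\infty}A_k:=\bigcap_{n=0}^\infty\bigcup_{k=n}^\infty A_k$. Setting. Let $m$ be a positive integer and, for each $i=1,\dots,m$, let $U_i:\mathcal{H}\to\mathcal{H}$ be $\alpha_i$-relaxed firmly nonexpansive with $\alpha_i\in(0,2]$. Let $\{q_k\}_{k=0}^\infty$ be a bounded sequence of positive integers, $\mathcal{M}:=\max_{k\in\mathbb{N}}q_k$, and $$\rho_{\{U_i\}_{i=1}^m}:=\min\left\{\mathcal{M}^{-1}\min_{i\in\{1,\dots,m\}}(2-\alpha_i)\alpha_i^{-1},\,1\right\}.$$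 For each $k\in\mathbb{N}$, let $\Omega_k$ be a nonempty set of functions from $\{1,\dots,q_k\}$ to $\{1,\dots,m\}$; for $t\in\Omega_k$ put $V_k[t]:=U_{t(q_k)}\cdots U_{t(2)}U_{t(1)}$ (composition); let $\omega_k:\Omega_k\to(0,1]$ satisfy $\sum_{t\in\Omega_k}\omega_k(t)=1$; and define $T_{(\Omega_k,\omega_k)}:=\sum_{t\in\Omega_k}\omega_k(t)V_k[t]$. Let $I:=\limsup_{k\to\infty}\{T_{(\Omega_k,\omega_k)}\}$ (the limsup of the sequence of singletons) and $C:=\bigcap_{T\in I}\mathrm{Fix}\,T$ (with $C=\mathcal{H}$ if $I=\emptyset$). Basic algorithm. Given $x^0\in\mathcal{H}$ and $\lambda_k\in[\varepsilon,1+\rho_{\{U_i\}_{i=1}^m}-\varepsilon]$ for each $k\in\mathbb{N}$ (with $\varepsilon\in(0,1]$), $$x^{k+1}:=x^k+\lambda_k\left(T_{(\Omega_k,\omega_k)}(x^k)-x^k\right),\quad k\in\mathbb{N}.$$ Superiorized algorithm. Given $y^0\in\mathcal{H}$, a sequence $\{N_k\}_{k=0}^\infty$ of positive integers, the positive numbers $\{\lambda_k\}_{k=0}^\infty$, and positive reals $\beta_{k,n}$ ($k\in\mathbb{N}$, $1\le n\le N_k$) with $\sum_{k=0}^\infty\sum_{n=1}^{N_k}\beta_{k,n}<\infty$, $$y^{k+1}:=y^k+\sum_{n=1}^{N_k}\beta_{k,n}v^{k,n}+\lambda_k\left(T_{(\Omega_k,\omega_k)}\Big(y^k+\sum_{n=1}^{N_k}\beta_{k,n}v^{k,n}\Big)-y^k-\sum_{n=1}^{N_k}\beta_{k,n}v^{k,n}\right),$$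 where, for each $k\in\mathbb{N}$ and $n=0,1,\dots,N_k-1$, $s^{k,n}$ is a selected element of $\partial\phi\big(y^k+\sum_{i=1}^{n}\beta_{k,i}v^{k,i}\big)$ (empty sums are $0$), and $v^{k,n+1}:=-\|s^{k,n}\|^{-1}s^{k,n}$ if $0\notin\partial\phi\big(y^k+\sum_{i=1}^{n}\beta_{k,i}v^{k,i}\big)$, while $v^{k,n+1}:=0$ if $0\in\partial\phi\big(y^k+\sum_{i=1}^{n}\beta_{k,i}v^{k,i}\big)$. *)

(* Defs.v *)
From HB Require Import structures.
From mathcomp Require Import all_boot all_order all_algebra.
From mathcomp Require Import sesquilinear.
From mathcomp Require Import all_classical all_reals all_analysis.

Set Implicit Arguments.
Unset Strict Implicit.
Unset Printing Implicit Defensive.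

Import Order.TTheory GRing.Theory Num.Theory.
Import numFieldNormedType.Exports.

Local Open Scope classical_set_scope.
Local Open Scope ring_scope.

(* A real Hilbert space is a complete normed space [H] together with a
   positive definite symmetric bilinear form [ip : {dot H for idfun}] inducing
   its norm. *)
Definition induces_norm (R : realType) (H : completeNormedModType R)
    (ip : {dot H for idfun}) : Prop :=
  forall x : H, `|x| = Num.sqrt (ip x x).

Definition max_nat (A : set nat) : nat := get [set a | A a /\ ubound A a].

Definition min_real (R : realType) (A : set R) : R :=
  get [set a | A a /\ lbound A a].

Definition Fix (H : Type) (T : H -> H) : set H := [set x | T x = x].

Section Operators.
Context (R : realType) (H : completeNormedModType R) (ip : {dot H for idfun}).

Definition relaxation (lam : R) (T : H -> H) : H -> H :=
  fun x => (1 - lam) *: x + lam *: T x.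

Definition firmly_nonexpansive (T : H -> H) : Prop :=
  forall x y, `|T x - T y| ^+ 2 <= ip (T x - T y) (x - y).

Definition relaxed_firmly_nonexpansive (lam : R) (T : H -> H) : Prop :=
  exists2 S : H -> H, firmly_nonexpansive S & T = relaxation lam S.

Definition subdifferential (phi : H -> R) (x : H) : set H :=
  [set g | forall y, ip g (y - x) <= phi y - phi x].

End Operators.

Section StringAveraging.
Context (R : realType) (H : completeNormedModType R).
Context (m : nat) (U : 'I_m -> H -> H).

(* The operators of [t] are applied from the first index to the last one,
   i.e. this is U_{t(q)} \o ... \o U_{t(1)}. *)
Definition string_op (q : nat) (t : {ffun 'I_q -> 'I_m}) : H -> H :=
  fun x => foldl (fun z i => U (t i) z) x (enum 'I_q).

Definition averaged_op (q : nat) (Omega : {set {ffun 'I_q -> 'I_m}})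
    (omega : {ffun 'I_q -> 'I_m} -> R) : H -> H :=
  fun x => \sum_(t in Omega) omega t *: string_op t x.

(* [omega] only matters on [Omega]: its values elsewhere are never used. *)
Definition is_weight (q : nat) (Omega : {set {ffun 'I_q -> 'I_m}})
    (omega : {ffun 'I_q -> 'I_m} -> R) : Prop :=
  (forall t, t \in Omega -> 0 < omega t <= 1) /\
  \sum_(t in Omega) omega t = 1.

Definition rho (q : nat -> nat) (alpha : 'I_m -> R) : R :=
  Num.min ((max_nat (range q))%:R^-1 *
           min_real (range (fun i => (2 - alpha i) / alpha i))) 1.

End StringAveraging.

Section Algorithms.
Context (R : realType) (H : completeNormedModType R) (ip : {dot H for idfun}).
Context (T : nat -> H -> H) (lam : nat -> R).

(* The intersection is [setT] when the limsup is empty. *)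
Definition common_fixed_points : set H :=
  \bigcap_(S in lim_sup_set (fun k => [set T k])) Fix S.

Definition basic_algorithm (x : nat -> H) : Prop :=
  forall k, x k.+1 = x k + lam k *: (T k (x k) - x k).

Context (phi : H -> R) (N : nat -> nat) (beta : nat -> nat -> R).

Definition perturbed (v : nat -> nat -> H) (y : nat -> H) (k n : nat) : H :=
  y k + \sum_(1 <= i < n.+1) beta k i *: v k i.

(* [beta k n] and [v k n] are meaningful for 1 <= n <= N k, and [s k n] for
   n < N k. *)
Definition superiorized_algorithm (s v : nat -> nat -> H) (y : nat -> H) :
    Prop :=
  forall k,
    (forall n, (n < N k)%N ->
      let d := subdifferential ip phi (perturbed v y k n) in
      [/\ d (s k n),
          ~ d 0 -> v k n.+1 = - (`|s k n|^-1 *: s k n) &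
          d 0 -> v k n.+1 = 0]) /\
    (let z := perturbed v y k (N k) in
     y k.+1 = z + lam k *: (T k z - z)).

End Algorithms.

(* Main.v *)
Require Import Defs.
From HB Require Import structures.
From mathcomp Require Import all_boot all_order all_algebra.
From mathcomp Require Import sesquilinear.
From mathcomp Require Import all_classical all_reals all_analysis.
From mathcomp Require Import ring lra.

Import Order.TTheory GRing.Theory Num.Theory.
Import numFieldNormedType.Exports.

Local Open Scope classical_set_scope.
Local Open Scope ring_scope.

(* The map [x |-> x + lam k *: (T k x - x)] is nonexpansive, since a string of
   at most [M] operators with constant [c] is strongly nonexpansive with
   constant [c / M >= rho], and this is stable under averaging; so it is enough
   that the perturbations strictly decrease the distance to [x k].  If
   [phi xlim < phi ylim], then by continuity [phi] is eventually smaller on a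
   ball of fixed radius [r] around [x k] than at every point met by the inner
   loop.  The subgradient inequality over this whole ball gives
   [<v, w - x k> < - r] for each step [v] taken from a point [w], which beats
   the second-order term once the step sizes are at most [r]. *)

Section RealDot.
Context {R : realType} {H : completeNormedModType R}.
Context (ip : {dot H for idfun}).

(** * Algebra and positivity of the inner product *)

Lemma ipC x y : ip x y = ip y x.
Proof. by rewrite hermC /= expr0 mul1r. Qed.

Lemma ipDl x y z : ip (x + y) z = ip x z + ip y z.
Proof. by rewrite linearDl. Qed.

Lemma ipBl x y z : ip (x - y) z = ip x z - ip y z.
Proof. by rewrite linearBl. Qed.

Lemma ipNl x z : ip (- x) z = - ip x z.
Proof. by rewrite linearNl. Qed.

Lemma ipZl a x z : ip (a *: x) z = a * ip x z.
Proof. by rewrite linearZl_LR. Qed.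

Lemma ipDr x y z : ip z (x + y) = ip z x + ip z y.
Proof. by rewrite linearDr. Qed.

Lemma ipBr x y z : ip z (x - y) = ip z x - ip z y.
Proof. by rewrite linearBr. Qed.

Lemma ipNr x z : ip z (- x) = - ip z x.
Proof. by rewrite linearNr. Qed.

Lemma ipZr a x z : ip z (a *: x) = a * ip z x.
Proof. by rewrite linearZr. Qed.

Lemma ip0l z : ip 0 z = 0.
Proof. by rewrite linear0l. Qed.

Lemma ip_suml (I : finType) (A : {pred I}) (f : I -> H) z :
  ip (\sum_(i in A) f i) z = \sum_(i in A) ip (f i) z.
Proof. by rewrite linear_sumlz. Qed.

Lemma ipxx_ge0 x : 0 <= ip x x.
Proof.
have [->|x0] := eqVneq x 0; first by rewrite ip0l.
exact/ltW/neq0_dnorm_gt0.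
Qed.

Definition ipE := (ipDl, ipBl, ipNl, ipZl, ipDr, ipBr, ipNr, ipZr).

(* Expanding the square of [sum_t a t *: (w t - sum_s a s *: w s)], i.e.
   nonnegativity of the variance. *)
Lemma ip_jensen (I : finType) (A : {pred I}) (a : I -> R) (w : I -> H) :
  (forall i, i \in A -> 0 <= a i) -> \sum_(i in A) a i = 1 ->
  ip (\sum_(i in A) a i *: w i) (\sum_(i in A) a i *: w i) <=
  \sum_(i in A) a i * ip (w i) (w i).
Proof.
move=> a0 a1; set W := \sum_(i in A) _.
have : 0 <= \sum_(i in A) a i * ip (w i - W) (w i - W).
  by apply: sumr_ge0 => i Ai; rewrite mulr_ge0 ?a0 ?ipxx_ge0.
under eq_bigr => i _.
  have -> : a i * ip (w i - W) (w i - W) =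
      a i * ip (w i) (w i) - 2 * ip (a i *: w i) W + a i * ip W W.
    rewrite !ipE (ipC W (w i)); ring.
  over.
by rewrite big_split /= sumrB -mulr_suml a1 -mulr_sumr -ip_suml -/W; lra.
Qed.

(** * Strong nonexpansiveness under relaxation, composition and averaging *)

(* With [w] the difference of the displacements of [F], this says
   [|F x - F y|^2 <= |x - y|^2 - c |w|^2]; it is the form in which the
   condition is visibly convex in [F] when [0 <= 1 + c]. *)
Definition strongly_nonexpansive (c : R) (F : H -> H) : Prop :=
  forall x y, let w := (x - y) - (F x - F y) in
  (1 + c) * ip w w <= 2 * ip w (x - y).

Lemma strongly_nonexpansive_le c d F :
  d <= c -> strongly_nonexpansive c F -> strongly_nonexpansive d F.
Proof.
move=> dc Fc x y /=; apply: le_trans (Fc x y).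
by rewrite ler_wpM2r ?ipxx_ge0 ?lerD2l.
Qed.

(** For [S], firmness amounts to [ip e e <= ip e D]. Relaxation scales [e] by [a], and
    [1 + (2 - a) / a = 2 / a], so the claim is this inequality times [2 * a]. *)
Lemma relaxed_strongly_nonexpansive (hip : induces_norm ip) (a : R)
    (F : H -> H) : 0 < a -> relaxed_firmly_nonexpansive ip a F ->
  strongly_nonexpansive ((2 - a) / a) F.
Proof.
move=> a0 [S Sf ->] x y /=.
have := Sf x y; rewrite hip sqr_sqrtr ?ipxx_ge0 // => {}Sf.
pose e := (x - y) - (S x - S y).
have -> : x - y - (relaxation a S x - relaxation a S y) = a *: e.
  have -> : relaxation a S x - relaxation a S y =
      (1 - a) *: (x - y) + a *: (S x - S y).
    by rewrite /relaxation !scalerBr opprD addrACA.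
  rewrite /e; set D := x - y.
  by rewrite scalerBl scale1r opprD addrA subKr -scalerBr.
have SE : S x - S y = (x - y) - e by rewrite /e subKr.
move: Sf; rewrite {}SE; clearbody e; move: (x - y) => D.
rewrite !ipE (ipC D e) => Sf.
have {}Sf : ip e e <= ip e D by lra.
have -> : (1 + (2 - a) / a) * (a * (a * ip e e)) = 2 * a * ip e e.
  by field; rewrite gt_eqF.
have -> : 2 * (a * ip e D) = 2 * a * ip e D by ring.
by rewrite ler_wpM2l // mulr_ge0 // ltW.
Qed.

Lemma foldl_strongly_nonexpansive (I : Type) (c : R) (F : I -> H -> H)
    (l : seq I) : 0 <= c -> (forall i, strongly_nonexpansive c (F i)) ->
  (0 < size l)%N ->
  strongly_nonexpansive (c / (size l)%:R)
    (fun x => foldl (fun z i => F i z) x l).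
Proof.
move=> c0 Fc l0 x y /=; set w := _ - _ - _.
suff : ((size l)%:R + c) * ip w w <= 2 * (size l)%:R * ip w (x - y).
  have n0 : 0 < (size l)%:R :> R by rewrite ltr0n.
  move=> h; rewrite -(ler_pM2l n0); set n := (size l)%:R in n0 h *.
  have -> : n * ((1 + c / n) * ip w w) = (n + c) * ip w w.
    by field; rewrite gt_eqF.
  by apply: le_trans h _; rewrite le_eqVlt; apply/orP; left; apply/eqP; ring.
rewrite {}/w {l0}; elim: l x y => [|i l IHl] x y /=.
  by rewrite !subrr ip0l; lra.
(* A one-element string is settled apart: the inductive step divides by the length of the tail. *)
case: l IHl => [_|j l]; first by have := Fc i x y; rewrite mulr1.
have : (0 < size (j :: l))%N by [].
move: {j l}(j :: l) => l l0 IHl.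
have := IHl (F i x) (F i y); have := Fc i x y => /=.
set x' := F i x; set y' := F i y.
set x'' := foldl _ x' _; set y'' := foldl _ y' _.
set w1 := x - y - (x' - y'); set w2 := x' - y' - (x'' - y'').
have -> : x - y - (x'' - y'') = w1 + w2 by rewrite /w1 /w2 subrKA.
have -> : x' - y' = (x - y) - w1 by rewrite /w1 subKr.
clearbody w1 w2; move: (x - y) => D; rewrite -[(size l).+1]addn1 natrD.
move=> h1 h2; have n0 : 0 < (size l)%:R :> R by rewrite ltr0n.
(* Adding [n * (n + 1)] times [h1] and [n + 1] times [h2] gives the goal with a surplus of exactly
   [c] times this square. *)
have sq := ipxx_ge0 ((size l)%:R *: w1 - w2).
set n := (size l)%:R in n0 h2 sq *; rewrite -(ler_pM2l n0).
rewrite !ipE (ipC w2 w1) in h1 h2 sq *.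
nra.
Qed.

(** As the weights sum to 1, the displacement of the average is the average of the displacements.
    Jensen bounds the quadratic side, and the other side is linear. *)
Lemma average_strongly_nonexpansive (I : finType) (A : {set I}) (a : I -> R)
    (V : I -> H -> H) (c : R) : -1 <= c ->
  (forall i, i \in A -> 0 <= a i) -> \sum_(i in A) a i = 1 ->
  (forall i, strongly_nonexpansive c (V i)) ->
  strongly_nonexpansive c (fun x => \sum_(i in A) a i *: V i x).
Proof.
move=> c1 a0 a1 Vc x y /=.
have -> : x - y - (\sum_(i in A) a i *: V i x - \sum_(i in A) a i *: V i y) =
    \sum_(i in A) a i *: (x - y - (V i x - V i y)).
  rewrite -sumrB -[x - y in LHS]scale1r -a1 scaler_suml -sumrB.
  by apply: eq_bigr => i _; rewrite !scalerBr.
apply: (@le_trans _ _ ((1 + c) * \sum_(i in A) a i *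
    ip (x - y - (V i x - V i y)) (x - y - (V i x - V i y)))).
  by rewrite ler_wpM2l ?ip_jensen//; lra.
rewrite ip_suml !mulr_sumr; apply: ler_sum => i Ai.
by rewrite ipZl mulrCA [leRHS]mulrCA ler_wpM2l ?a0//; exact: Vc.
Qed.

(** Expanding [D - l *: w] bounds its square by that of [D] minus [l * (1 + c - l) * ip w w]. *)
Lemma strongly_nonexpansive_relaxation (hip : induces_norm ip) (c l : R)
    (F : H -> H) : 0 <= l <= 1 + c -> strongly_nonexpansive c F ->
  forall x y, `|x + l *: (F x - x) - (y + l *: (F y - y))| <= `|x - y|.
Proof.
move=> /andP[l0 lc] Fc x y; rewrite !hip ler_wsqrtr//.
have := Fc x y; set w := x - y - (F x - F y) => /= h.
have -> : x + l *: (F x - x) - (y + l *: (F y - y)) = (x - y) - l *: w.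
  rewrite opprD addrACA -scalerBr -scalerN /w; congr (_ + _ *: _).
  by rewrite [RHS]opprB !opprD !opprK addrACA.
clearbody w; move: (x - y) h => D h; rewrite !ipE (ipC D w).
have lh := ler_wpM2l l0 h.
have lw : 0 <= l * (1 + c - l) * ip w w.
  by rewrite !mulr_ge0 ?subr_ge0 ?ipxx_ge0.
lra.
Qed.

(** * Descent of the perturbation steps towards a point *)

(* The subgradient inequality at the point [p + r *: (g / |g|)], where [phi]
   is below [phi w], shows that the normalised descent direction decreases
   the distance to [p] at rate more than [r]. *)
Lemma subgradient_step (hip : induces_norm ip) (phi : H -> R) (w p g : H)
    (b r : R) : subdifferential ip phi w g ->
  (forall u, `|u - p| <= r -> phi u < phi w) -> 0 < b <= r ->
  `|w + b *: (- (`|g|^-1 *: g)) - p| < `|w - p|.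
Proof.
move=> gw hphi /andP[b0 br]; have r0 : 0 < r by exact: lt_le_trans br.
have g0 : g != 0.
  apply/eqP => g0; have := gw p; rewrite g0 ip0l.
  by have := hphi p; rewrite subrr normr0 (ltW r0) => /(_ isT); lra.
have ng0 : 0 < `|g| by rewrite normr_gt0.
set e := `|g|^-1 *: g.
have ee : ip e e = 1.
  rewrite /e ipZl ipZr -[ip g g]sqr_sqrtr ?ipxx_ge0// -hip.
  by field; rewrite gt_eqF.
have gE : g = `|g| *: e by rewrite /e scalerA divff ?scale1r ?gt_eqF.
have h : r < ip e (w - p).
  have := gw (p + r *: e); have := hphi (p + r *: e).
  rewrite addrC addKr hip ipZl ipZr ee mulr1 -expr2 sqrtr_sqr gtr0_norm//.
  move=> /(_ (lexx r)) lt1 le1; have : ip g (r *: e + p - w) < 0 by lra.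
  rewrite {1}gE ipZl pmulr_rlt0// -addrA ipDr ipZr ee -(opprB w p) ipNr; lra.
clearbody e; rewrite !hip -addrA addrCA; move: (w - p) h => D h.
have -> : b *: - e + D = D - b *: e by rewrite addrC scalerN.
have D0 : D != 0 by apply/eqP => D0; move: h; rewrite D0 ipC ip0l; lra.
(* The square changes by [b * (b - 2 * ip e D)], negative since [b <= r < ip e D]. *)
rewrite ltr_sqrt ?neq0_dnorm_gt0// !ipE ee (ipC D e); nra.
Qed.

(** Steps have norm at most 1, so the inner loop stays within [r] of [y k], where every nonzero step
    falls under [subgradient_step]. *)
Lemma superiorized_step (hip : induces_norm ip) (T : nat -> H -> H)
    (lam : nat -> R) (phi : H -> R) (N : nat -> nat) (beta : nat -> nat -> R)
    (s v : nat -> nat -> H) (y : nat -> H) (k : nat) (p : H) (r : R) :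
  superiorized_algorithm ip T lam phi N beta s v y -> (0 < N k)%N ->
  (forall n, (1 <= n <= N k)%N -> 0 < beta k n) ->
  \sum_(1 <= n < (N k).+1) beta k n <= r ->
  (forall u w, `|u - p| <= r -> `|w - y k| <= r -> phi u < phi w) ->
  `|perturbed beta v y k (N k) - p| < `|y k - p|.
Proof.
move=> /(_ k)[hy _] Nk0 b0 br hphi.
pose S n := \sum_(1 <= i < n.+1) beta k i; pose z := perturbed beta v y k.
have SS n : S n.+1 = S n + beta k n.+1 by rewrite /S big_nat_recr.
have zS n : z n.+1 = z n + beta k n.+1 *: v k n.+1.
  by rewrite /z /perturbed big_nat_recr//= addrA.
have z0 : z 0%N = y k by rewrite /z /perturbed big_geq ?addr0.
have Sr n : (n <= N k)%N -> 0 <= S n <= r.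
  move=> nN; apply/andP; split.
    rewrite /S big_nat; apply: sumr_ge0 => i /andP[i1 iN].
    by apply/ltW/b0; rewrite i1 (leq_trans _ nN).
  apply: le_trans br; rewrite [leRHS](@big_cat_nat _ _ _ n.+1)//= lerDl.
  rewrite big_nat; apply: sumr_ge0 => i /andP[ni iN].
  by apply/ltW/b0; rewrite (leq_ltn_trans _ ni).
have r0 : 0 <= r by have /andP[S0] := Sr 0%N isT; exact: le_trans.
have vE n : (n < N k)%N -> `|z n - y k| <= r ->
    v k n.+1 = - (`|s k n|^-1 *: s k n).
  move=> nN zr; have [_ -> //] := hy n nN.
  (* A zero subgradient would make [z n] a minimiser, although [phi p < phi (z n)]. *)
  move=> /(_ p); rewrite ip0l; have := hphi p _ _ zr.
  by rewrite subrr normr0 => /(_ r0); rewrite -/z; lra.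
have zy n : (n <= N k)%N -> `|z n - y k| <= S n.
  elim: n => [_|n IHn nN]; first by rewrite z0 subrr normr0 /S big_geq.
  have zSn := IHn (ltnW nN); have /andP[_ Snr] := Sr n (ltnW nN).
  rewrite zS addrAC SS (le_trans (ler_normD _ _))// lerD//.
  have bn : 0 < beta k n.+1 by exact: b0.
  rewrite normrZ gtr0_norm// ler_piMr ?(ltW bn)// vE ?(le_trans zSn)//.
  rewrite normrN normrZ normfV normr_id.
  by have [->|s0] := eqVneq `|s k n| 0;  rewrite ?mulr0 ?ler01// mulVf.
have zp n : (n < N k)%N -> `|z n.+1 - p| < `|z n - p|.
  move=> nN; have /andP[Sn0 Snr] := Sr _ (ltnW nN).
  have znr : `|z n - y k| <= r by rewrite (le_trans (zy _ (ltnW nN))).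
  rewrite zS vE//; apply: (subgradient_step hip phi _ _ _ _ r).
  - by have [] := hy n nN.
  - by move=> u ur; exact: hphi.
  - rewrite b0//=; have /andP[_] := Sr _ nN; rewrite SS; lra.
rewrite -/(z _) -z0; case: (N k) Nk0 zp => // M _ zp.
elim: M zp => [|M IHM] zp; first exact: zp.
by apply: lt_trans (IHM _); [exact: zp|move=> n nM; apply: zp; exact: ltnW].
Qed.

End RealDot.

(** Both extrema hidden behind [get] are attained: [q] is bounded and there are finitely many
    indices, at least one. The witness [c] is the minimal constant of the operators. *)
Lemma rho_le {R : realType} {m : nat} (hm : (0 < m)%N) (q : nat -> nat)
    (hq : forall k, (0 < q k)%N) (hqb : exists B : nat, forall k, (q k <= B)%N)
    (alpha : 'I_m -> R) (halpha : forall i, 0 < alpha i <= 2) :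
  exists2 c : R, 0 <= c & (forall i, c <= (2 - alpha i) / alpha i) /\
    forall k, rho q alpha <= c / (q k)%:R.
Proof.
have [M_in M_ub] : [set a | range q a /\ ubound (range q) a]
    (max_nat (range q)).
  apply: (@getPex nat); have [B hB] := hqb.
  have ex : exists n, `[< range q n >].
    by exists (q 0%N); apply/asboolP; exists 0%N.
  have ub n : `[< range q n >] -> (n <= B)%N by move=> /asboolP[k _ <-].
  case: (ex_maxnP ex ub) => M /asboolP Mr Mub.
  by exists M; split=> // _ [k _ <-]; apply: Mub; apply/asboolP; exists k.
have [] : [set a | range (fun i => (2 - alpha i) / alpha i) a /\
    lbound (range (fun i => (2 - alpha i) / alpha i)) a]
    (Defs.min_real (range (fun i => (2 - alpha i) / alpha i))).
  apply: (@getPex R); pose i0 := Ordinal hm.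
  have [i _ imin] := @Order.TotalTheory.arg_minP _ R _ i0 xpredT
    (fun i => (2 - alpha i) / alpha i) isT.
  exists ((2 - alpha i) / alpha i).
  by split; [exists i|move=> _ [j _ <-]; apply: imin].
rewrite /rho; set c := Defs.min_real _; set M := max_nat _ in M_in M_ub *.
move=> [i _ ci] clb; have c0 : 0 <= c.
  rewrite -ci; have /andP[a0 a2] := halpha i.
  by rewrite divr_ge0 ?subr_ge0// ltW.
exists c => //; split=> [j|k]; first by apply: clb; exists j.
rewrite ge_min; apply/orP; left; rewrite mulrC ler_wpM2l//.
have qM : (q k <= M)%N by apply: M_ub; exists k.
by rewrite lef_pV2 ?posrE ?ltr0n ?ler_nat// (leq_trans _ qM).
Qed.

Theorem theorem3p2
  (R : realType) (H : completeNormedModType R) (ip : {dot H for idfun})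
  (hip : induces_norm ip)
  (m : nat) (hm : (0 < m)%N)
  (U : 'I_m -> H -> H) (alpha : 'I_m -> R)
  (halpha : forall i, 0 < alpha i <= 2)
  (hU : forall i, relaxed_firmly_nonexpansive ip (alpha i) (U i))
  (q : nat -> nat) (hq : forall k, (0 < q k)%N)
  (hqb : exists B : nat, forall k, (q k <= B)%N)
  (Omega : forall k, {set {ffun 'I_(q k) -> 'I_m}})
  (hOmega : forall k, Omega k != finset.set0)
  (omega : forall k, {ffun 'I_(q k) -> 'I_m} -> R)
  (homega : forall k, is_weight (Omega k) (omega k))
  (T : nat -> H -> H)
  (hT : forall k, T k = averaged_op U (Omega k) (omega k))
  (phi : H -> R)
  (hphic : convex_function [set: H] phi) (hphi : continuous phi)
  (eps : R) (heps : 0 < eps)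
  (lam : nat -> R)
  (hlam : forall k, eps <= lam k <= 1 + rho q alpha - eps)
  (x : nat -> H) (hx : basic_algorithm T lam x)
  (xlim : H) (hxlim : common_fixed_points T xlim) (hxcvg : x @ \oo --> xlim)
  (N : nat -> nat) (hN : forall k, (0 < N k)%N)
  (beta : nat -> nat -> R)
  (hbeta : forall k n, (1 <= n <= N k)%N -> 0 < beta k n)
  (hbetasum :
    (\sum_(0 <= k <oo) (\sum_(1 <= n < (N k).+1) beta k n)%:E < +oo)%E)
  (s v : nat -> nat -> H) (y : nat -> H) (hy0 : y 0%N = x 0%N)
  (hy : superiorized_algorithm ip T lam phi N beta s v y)
  (ylim : H) (hylim : common_fixed_points T ylim) (hycvg : y @ \oo --> ylim) :
  let alt1 := phi ylim <= phi xlim in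
  let alt2 := phi xlim < phi ylim /\
    exists k0 : nat, forall k, (k0 <= k)%N ->
      `|y k.+1 - x k.+1| < `|y k - x k| in
  (alt1 \/ alt2) /\ ~ (alt1 /\ alt2).
Proof.
move=> alt1 alt2; split; last first.
  by move=> [h1 [h2 _]]; move: h2; rewrite ltNge => /negP; exact.
have [|lt_phi] := leP (phi ylim) (phi xlim); first by left.
right; split=> //.
pose mid := (phi xlim + phi ylim) / 2.
have [dx /= dx0 hdx] : exists2 d : R, 0 < d &
    forall u, `|xlim - u| < d -> phi u < mid.
  have /nbhs_normP[d d0 hd] : \forall u \near xlim, phi u < mid.
    by apply: (cvgr_lt _ (hphi xlim)); rewrite /mid; lra.
  by exists d.
have [dy /= dy0 hdy] : exists2 d : R, 0 < d &
    forall u, `|ylim - u| < d -> mid < phi u.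
  have /nbhs_normP[d d0 hd] : \forall u \near ylim, mid < phi u.
    by apply: (cvgr_gt _ (hphi ylim)); rewrite /mid; lra.
  by exists d.
(* Halved so that one [r] covers the distance from an iterate to its limit and another the ball
   around that iterate. *)
pose r := Num.min dx dy / 2.
have [rx ry] : r + r <= dx /\ r + r <= dy.
  have : Num.min dx dy <= dx /\ Num.min dx dy <= dy.
    by rewrite !ge_min !lexx orbT.
  by rewrite /r; lra.
have r0 : 0 < r by rewrite /r divr_gt0// lt_min dx0.
have b0 k : 0 <= \sum_(1 <= n < (N k).+1) beta k n.
  by rewrite big_nat; apply: sumr_ge0 => n n1N; apply/ltW/hbeta.
(* Summability makes the total step length of the inner loop tend to 0. *)
have bcvg := cvg_series_cvg_0 (nnseries_is_cvg b0 hbetasum).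
have [k0 _ hk0] : \forall k \near \oo, [/\ `|xlim - x k| < r,
    `|ylim - y k| < r & \sum_(1 <= n < (N k).+1) beta k n <= r].
  near=> k; split.
  - by near: k; move/cvgrPdist_lt : hxcvg => /(_ r r0).
  - by near: k; move/cvgrPdist_lt : hycvg => /(_ r r0).
  - by near: k; apply: (cvgr_le _ bcvg).
exists k0 => k /hk0 /= [xk yk bk].
have [_ ->] := hy k; rewrite hx.
have [c c0 [calpha rhoc]] := rho_le hm q hq hqb alpha halpha.
have Tk : strongly_nonexpansive ip (rho q alpha) (T k).
  apply: (strongly_nonexpansive_le ip _ _ _ (rhoc k)).
  rewrite hT; have [w01 w1] := homega k.
  apply: average_strongly_nonexpansive w1 _.
  - by rewrite (le_trans (lerN10 _))// divr_ge0.
  - by move=> t /w01 /andP[/ltW].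
  - move=> t; have := @foldl_strongly_nonexpansive _ _ ip _ c
      (fun i => U (t i)) (enum 'I_(q k)) c0; rewrite size_enum_ord.
    apply=> // i.
    apply: strongly_nonexpansive_le (calpha (t i)) _.
    by apply: relaxed_strongly_nonexpansive; have /andP[] := halpha (t i).
(* The relaxed operator does not increase distances, which leaves a strict decrease to be shown for
   the perturbation alone. *)
apply: le_lt_trans (strongly_nonexpansive_relaxation ip hip _ _ _ _ Tk _ _) _.
  by have /andP[l1 l2] := hlam k; apply/andP; split; lra.
apply: (superiorized_step ip hip _ _ _ _ _ _ _ _ _ _ r hy) => //.
  exact: hbeta.
move=> u w ux wy; apply: (@lt_trans _ _ mid).
  apply: hdx; rewrite -(subrKA (x k)) (le_lt_trans (ler_normD _ _))//.
  by rewrite distrC in ux; lra.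
apply: hdy; rewrite -(subrKA (y k)) (le_lt_trans (ler_normD _ _))//.
by rewrite distrC in wy; lra.
Unshelve. all: by end_near. Qed.
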